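(* Let $p(z)$ be an analytic polynomial of degree $n$ and let $q(z)$ be an analytic polynomial of degree $m$ (polynomials in $z$ with complex coefficients), and suppose that $q$ is not a constant multiple of $p$, i.e. there is no constant $\alpha \in \mathbb{C}$ with $q(z) = \alpha p(z)$ for all $z$. Let $f(z) = p(z)\overline{q(z)}$ for $z \in \mathbb{C}$. Then $\mathcal{Z}_f \leq m+n$.
   Context: For a function $f:\mathbb{C}\to\mathbb{C}$, $\mathcal{Z}_f$ denotes the number of zeros of $f$, that is, the number of (distinct) points $z\in\mathbb{C}$ satisfying $f(z)=0$. An analytic polynomial is an ordinary polynomial in the single complex variable $z$ with complex coefficients; $\overline{q(z)}$ denotes the complex conjugate of $q(z)$. *)

(* Defs.v *)
From mathcomp Require Import all_boot all_order all_algebra.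
From mathcomp Require Import boolp classical_sets cardinality reals.
From mathcomp Require Import constructive_ereal ereal measure.
From mathcomp Require Export complex.

Set Implicit Arguments.
Unset Strict Implicit.
Unset Printing Implicit Defensive.

Import Order.TTheory GRing.Theory Num.Theory.
Local Open Scope classical_set_scope.
Local Open Scope ring_scope.
Local Open Scope complex_scope.

(* Zeros are counted as distinct points, without multiplicity; the value is
   +oo when there are infinitely many of them. *)
Definition num_zeros (R : realType) (f : R[i] -> R[i]) : \bar R :=
  counting [set z | f z = 0].

(* [size p] is the degree plus one, and is 0 for the zero polynomial, which
   therefore has no degree. *)
Definition has_degree (R : nzRingType) (p : {poly R}) (n : nat) : Prop :=
  size p = n.+1.

(* Main.v *)
Require Import Defs.
From mathcomp Require Import all_boot all_order all_algebra.
From mathcomp Require Import boolp classical_sets cardinality reals.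
From mathcomp Require Import constructive_ereal ereal measure.
From mathcomp Require Import complex.
From mathcomp Require Import finmap.

Import Order.TTheory GRing.Theory Num.Theory.
Local Open Scope ring_scope.
Local Open Scope complex_scope.

(** Conjugation is injective and fixes 0, so [p * conj q] vanishes at exactly
    the points where the analytic polynomial [p * q] does.  Since [p] and [q]
    have degrees [n] and [m], their product is nonzero of degree [m + n], and
    a nonzero polynomial over an integral domain has at most as many distinct
    roots as its degree ([counting_roots_le]). *)

(** An infinite root set would contain a finite set with [size p] elements,
    already too many for [max_poly_roots], so the counting measure takes its
    finite value. *)
Lemma counting_roots_le (R : realType) (F : idomainType) (p : {poly F}) :
  p != 0 ->
  ((counting [set z | root p z]%classic : \bar R) <= (size p).-1%:R%:E)%E.
Proof.
move=> p_neq0.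
have card_roots (B : {fset F}) :
    ([set` B] `<=` [set z | root p z])%classic -> (#|` B| < size p)%N.
  move=> B_roots; apply: (max_poly_roots p_neq0); last exact: fset_uniq.
  by apply/allP => z zB; apply: B_roots.
have fin_roots : finite_set [set z | root p z]%classic.
  apply: contrapT => /(infinite_set_fset (size p))[B /card_roots].
  by rewrite ltnNge => /negbTE ->.
rewrite /counting asboolT // lee_fin ler_nat.
rewrite -ltnS prednK ?size_poly_gt0 //; apply: card_roots.
by rewrite fset_setK.
Qed.

Theorem theorem2p1 (R : realType) (n m : nat) (p q : {poly R[i]})
  (hp : has_degree p n) (hq : has_degree q m)
  (hpq : ~ exists alpha : R[i], forall z : R[i], q.[z] = alpha * p.[z])
  (f : R[i] -> R[i]) (hf : forall z : R[i], f z = p.[z] * (q.[z])^*) :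
  (num_zeros f <= (m + n)%:R%:E)%E.
Proof.
have p_neq0 : p != 0 by rewrite -size_poly_eq0 hp.
have q_neq0 : q != 0 by rewrite -size_poly_eq0 hq.
have zerosE : [set z | f z = 0]%classic = [set z | root (p * q) z]%classic.
  apply/funext => z; apply/propext => /=.
  rewrite hf rootM !rootE; split=> [/eqP|pq0]; last apply/eqP.
    by rewrite mulf_eq0 fmorph_eq0.
  by rewrite mulf_eq0 fmorph_eq0.
have -> : (m + n)%N = (size (p * q)%R).-1.
  by rewrite size_mul // hp hq addSn addnS addnC.
by rewrite /num_zeros zerosE counting_roots_le // mulf_neq0.
Qed.
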